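(* Let $F_1,G_1:X_1\to H_1$ be a dual pair of continuous Bessel families associated to $(a_2,\dots,a_n)$ for $H_1$ with respect to $(X_1,\mu_1)$ having bounds $B_1,B_2$, and let $F_2,G_2:X_2\to H_2$ be a dual pair of continuous Bessel families associated to $(b_2,\dots,b_n)$ for $H_2$ with respect to $(X_2,\mu_2)$ having bounds $D_1,D_2$. Then $\mathcal{G}=G_1\otimes G_2:X\to H_1\otimes H_2$ is a dual continuous frame associated to $(a_2\otimes b_2,\dots,a_n\otimes b_n)$ for $H_1\otimes H_2$ with respect to $(X,\mu)$ of $\mathcal{F}=F_1\otimes F_2:X\to H_1\otimes H_2$.
   Context: Let $n\ge 2$. An $n$-inner product on a complex vector space $H$ with $\dim H\ge n$ is a map $(x,y,x_2,\dots,x_n)\mapsto\langle x,y\mid x_2,\dots,x_n\rangle\in\mathbb{C}$ such that: (i) $\langle x_1,x_1\mid x_2,\dots,x_n\rangle\ge 0$, with equality iff $x_1,\dots,x_n$ are linearly dependent; (ii) it is invariant under permutations of $x_2,\dots,x_n$; (iii) $\langle x,y\mid x_2,\dots,x_n\rangle=\overline{\langle y,x\mid x_2,\dots,x_n\rangle}$; (iv), (v) it is linear in $x$. The induced $n$-norm is $\|x_1,x_2,\dots,x_n\|=\langle x_1,x_1\mid x_2,\dots,x_n\rangle^{1/2}$. $H$ is an $n$-Hilbert space if it is complete: every sequence $(x_k)$ with $\|x_l-x_k,e_2,\dots,e_n\|\to0$ for all $e_2,\dots,e_n\in H$ has some $x\in H$ with $\|x_k-x,e_2,\dots,e_n\|\to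 0$ for all $e_2,\dots,e_n\in H$. $H_1,H_2$ are complex $n$-Hilbert spaces with $n$-inner products $\langle\cdot,\cdot\mid\cdot,\dots,\cdot\rangle_1$, $\langle\cdot,\cdot\mid\cdot,\dots,\cdot\rangle_2$ and induced $n$-norms $\|\cdot,\dots,\cdot\|_1$, $\|\cdot,\dots,\cdot\|_2$; $a_2,\dots,a_n\in H_1$ are linearly independent, and $b_2,\dots,b_n\in H_2$ are linearly independent. $H_F$ is the Hilbert space completion of $H_1/\operatorname{span}\{a_2,\dots,a_n\}$ under the inner product induced by $\langle x,y\rangle_F=\langle x,y\mid a_2,\dots,a_n\rangle_1$, and $H_G$ is the completion of $H_2/\operatorname{span}\{b_2,\dots,b_n\}$ under that induced by $\langle x,y\rangle_G=\langle x,y\mid b_2,\dots,b_n\rangle_2$ (the subscripts $F,G$ refer to the sets $\{a_i\}$, $\{b_i\}$). Elements of $H_1$, $H_2$ are identified with their images in $H_F$, $H_G$, and elementary tensors of $H_1\otimes H_2$ with their images in the Hilbert space tensor product $H_F\otimes H_G$. For elementary tensors, $\langle f\otimes g,f_1\otimes g_1\mid a_2\otimes b_2,\dots,a_n\otimes b_n\rangle=\langle f,f_1\mid a_2,\dots,a_n\rangle_1\langle g,g_1\mid b_2,\dots,b_n\rangle_2$ and $\|f\otimes g,a_2\otimes b_2,\dots,a_n\otimes b_n\|=\|f,a_2,\dots,a_n\|_1\|g,b_2,\dots,b_n\|_2$. $(X,\mu)=(X_1\times X_2,\mu_1\otimes\mu_2)$ is the product of measure spaces with $\sigma$-finite positive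 measures, and $(F_1\otimes F_2)(x_1,x_2)=F_1(x_1)\otimes F_2(x_2)$. $F_1:X_1\to H_1$ is a continuous Bessel family associated to $(a_2,\dots,a_n)$ with bound $B<\infty$ if for every $f\in H_1$ the function $x_1\mapsto\langle f,F_1(x_1)\mid a_2,\dots,a_n\rangle_1$ is measurable and $\int_{X_1}|\langle f,F_1(x_1)\mid a_2,\dots,a_n\rangle_1|^2d\mu_1(x_1)\le B\|f,a_2,\dots,a_n\|_1^2$ for all $f\in H_1$. $F_1,G_1$ is a dual pair of continuous Bessel families associated to $(a_2,\dots,a_n)$ with bounds $B_1,B_2$ if $F_1$, $G_1$ are continuous Bessel families with bounds $B_1$, $B_2$ respectively and $\langle f,g\mid a_2,\dots,a_n\rangle_1=\int_{X_1}\langle f,F_1(x_1)\mid a_2,\dots,a_n\rangle_1\langle G_1(x_1),g\mid a_2,\dots,a_n\rangle_1d\mu_1(x_1)$ for all $f,g\in H_1$. The notions for $F_2,G_2$ are the same with $(b_2,\dots,b_n)$, $H_2$, $(X_2,\mu_2)$. A mapping $\mathcal{F}=F_1\otimes F_2$ is a continuous frame associated to $(a_2\otimes b_2,\dots,a_n\otimes b_n)$ for $H_1\otimes H_2$ with respect to $(X,\mu)$ if for all $f\in H_1$, $g\in H_2$ the function $x\mapsto\langle f\otimes g,\mathcal{F}(x)\mid a_2\otimes b_2,\dots,a_n\otimes b_n\rangle$ is measurable and there are constants $A,B>0$ with $A\|f\otimes g,a_2\otimes b_2,\dots,a_n\otimes b_n\|^2\le\int_X|\langle f\otimes g,\mathcal{F}(x)\mid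 a_2\otimes b_2,\dots,a_n\otimes b_n\rangle|^2d\mu(x)\le B\|f\otimes g,a_2\otimes b_2,\dots,a_n\otimes b_n\|^2$ for all $f\in H_1$, $g\in H_2$. $\mathcal{G}$ is a dual continuous frame associated to $(a_2\otimes b_2,\dots,a_n\otimes b_n)$ of $\mathcal{F}$ if both $\mathcal{F}$ and $\mathcal{G}$ are continuous frames associated to $(a_2\otimes b_2,\dots,a_n\otimes b_n)$ and $$f\otimes g=\int_X\langle f\otimes g,\mathcal{F}(x)\mid a_2\otimes b_2,\dots,a_n\otimes b_n\rangle\,\mathcal{G}(x)\,d\mu(x)\quad\text{for all } f\in H_1,\ g\in H_2,$$ as an identity in $H_F\otimes H_G$ with the integral in the weak sense. *)

(* Defs.v *)
From HB Require Import structures.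
From mathcomp Require Import all_boot all_order all_algebra.
From mathcomp Require Import sesquilinear.
From mathcomp Require Import all_classical all_reals all_analysis.
From mathcomp Require Import complex.

Set Implicit Arguments.
Unset Strict Implicit.
Unset Printing Implicit Defensive.

Import Order.TTheory GRing.Theory Num.Theory.
Import numFieldNormedType.Exports.

Local Open Scope classical_set_scope.
Local Open Scope ring_scope.

(* MathComp's [free] and [span] require a finite-dimensional space. *)
Definition lin_indep (K : pzRingType) (H : lmodType K) (m : nat)
    (v : m.-tuple H) : Prop :=
  forall c : 'I_m -> K,
    \sum_(i < m) c i *: tnth v i = 0 -> forall i, c i = 0.

Definition in_span (K : pzRingType) (H : lmodType K) (m : nat)
    (v : m.-tuple H) (x : H) : Prop :=
  exists c : 'I_m -> K, x = \sum_(i < m) c i *: tnth v i.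

Definition dim_ge (K : pzRingType) (H : lmodType K) (n : nat) : Prop :=
  exists v : n.-tuple H, lin_indep v.

(* [nip x y e] is <x, y | x_2, ..., x_n> with e = (x_2, ..., x_n), hence a
   tuple of length n.-1.  For z complex, [0 <= z] says that z is real and
   nonnegative. *)
Record nInnerProduct (R : realType) (n : nat) (H : lmodType R[i]) := {
  nip :> H -> H -> n.-1.-tuple H -> R[i];
  nip_ge0 : forall x e, 0 <= nip x x e;
  nip_eq0 : forall x e, nip x x e = 0 <-> ~ lin_indep [tuple of x :: e];
  nip_perm : forall x y (e e' : n.-1.-tuple H),
    perm_eq e e' -> nip x y e = nip x y e';
  nip_conj : forall x y e, nip x y e = (nip y x e)^*;
  nipD : forall x x' y e, nip (x + x') y e = nip x y e + nip x' y e;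
  nipZ : forall c x y e, nip (c *: x) y e = c * nip x y e
}.

Definition nnorm (R : realType) (n : nat) (H : lmodType R[i])
    (ip : nInnerProduct n H) (x : H) (e : n.-1.-tuple H) : R :=
  Num.sqrt (complex.Re (ip x x e)).

Definition nHilbert (R : realType) (n : nat) (H : lmodType R[i])
    (ip : nInnerProduct n H) : Prop :=
  forall u : nat -> H,
    (forall e, (fun lk : nat * nat => nnorm ip (u lk.1 - u lk.2) e)
                 @ (\oo, \oo) --> (0 : R)) ->
    exists x : H, forall e,
      (fun k : nat => nnorm ip (u k - x) e) @ \oo --> (0 : R).

(* Inner products are MathComp's [{dot H for Num.conj}]: linear on the left,
   conjugate-linear on the right and positive definite. *)
Definition hnorm (R : realType) (H : lmodType R[i])
    (dot : {dot H for (@Num.conj R[i])}) (u : H) : R :=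
  Num.sqrt (complex.Re (dot u u)).

Definition hilbert (R : realType) (H : lmodType R[i])
    (dot : {dot H for (@Num.conj R[i])}) : Prop :=
  forall u : nat -> H,
    (fun lk : nat * nat => hnorm dot (u lk.1 - u lk.2))
      @ (\oo, \oo) --> (0 : R) ->
    exists x : H, (fun k : nat => hnorm dot (u k - x)) @ \oo --> (0 : R).

(* (HF, dotF), with the canonical map iota : H -> HF, is the completion of
   H / span a under the inner product induced by <x, y | a>: by [qc_ker] and
   [qc_dot], iota factors through an isometric embedding of the quotient,
   whose range is dense by [qc_dense].  This determines (HF, iota) up to a
   unique isometric isomorphism. *)
Record quotient_completion (R : realType) (n : nat) (H : lmodType R[i])
    (ip : nInnerProduct n H) (a : n.-1.-tuple H)
    (HF : lmodType R[i]) (dotF : {dot HF for (@Num.conj R[i])})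
    (iota : {linear H -> HF}) : Prop := {
  qc_hilbert : hilbert dotF;
  qc_ker : forall x, iota x = 0 <-> in_span a x;
  qc_dot : forall x y, dotF (iota x) (iota y) = ip x y a;
  qc_dense : forall (u : HF) (eps : R), 0 < eps ->
    exists x : H, hnorm dotF (u - iota x) < eps
}.

(* (T, dotT), with the bilinear map tens, is the Hilbert space tensor product
   of (HF, dotF) and (HG, dotG): [ht_dot] makes the induced map on the
   algebraic tensor product isometric, and [ht_dense] makes its range dense. *)
Record hilbert_tensor (R : realType) (HF HG T : lmodType R[i])
    (dotF : {dot HF for (@Num.conj R[i])})
    (dotG : {dot HG for (@Num.conj R[i])})
    (dotT : {dot T for (@Num.conj R[i])})
    (tens : {bilinear HF -> HG -> T}) : Prop := {
  ht_hilbert : hilbert dotT;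
  ht_dot : forall u v u' v',
    dotT (tens u v) (tens u' v') = dotF u u' * dotG v v';
  ht_dense : forall (t : T) (eps : R), 0 < eps ->
    exists (m : nat) (u : 'I_m -> HF) (v : 'I_m -> HG),
      hnorm dotT (t - \sum_(i < m) tens (u i) (v i)) < eps
}.

Section ComplexIntegral.
Context (R : realType) (d : measure_display) (X : measurableType d).

Definition cmeasurable (f : X -> R[i]) : Prop :=
  measurable_fun setT (fun x => complex.Re (f x)) /\
  measurable_fun setT (fun x => complex.Im (f x)).

Definition cintegrable (mu : {measure set X -> \bar R}) (f : X -> R[i]) :
    Prop :=
  mu.-integrable setT (fun x => (complex.Re (f x))%:E) /\
  mu.-integrable setT (fun x => (complex.Im (f x))%:E).

Definition cintegral (mu : {measure set X -> \bar R}) (f : X -> R[i]) :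
    R[i] :=
  Complex (Rintegral mu setT (fun x => complex.Re (f x)))
          (Rintegral mu setT (fun x => complex.Im (f x))).

(* v is the integral of Phi against mu in the weak sense. *)
Definition weak_integral (mu : {measure set X -> \bar R})
    (T : lmodType R[i]) (dotT : {dot T for (@Num.conj R[i])})
    (Phi : X -> T) (v : T) : Prop :=
  forall h : T,
    cintegrable mu (fun x => dotT (Phi x) h) /\
    dotT v h = cintegral mu (fun x => dotT (Phi x) h).

End ComplexIntegral.

Section Bessel.
Context (R : realType) (n : nat) (H : lmodType R[i])
  (ip : nInnerProduct n H) (a : n.-1.-tuple H)
  (d : measure_display) (X : measurableType d)
  (mu : {measure set X -> \bar R}).

Definition bessel_family (F : X -> H) (B : R) : Prop :=
  (forall f : H, cmeasurable (fun x => ip f (F x) a)) /\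
  (forall f : H,
     (\int[mu]_x ((Normc.normc (ip f (F x) a)) ^+ 2)%:E
        <= (B * (nnorm ip f a) ^+ 2)%:E)%E).

Definition dual_bessel_pair (F G : X -> H) (B B' : R) : Prop :=
  [/\ bessel_family F B, bessel_family G B' &
      forall f g : H,
        ip f g a = cintegral mu (fun x => ip f (F x) a * ip (G x) g a)].

End Bessel.

Section TensorFrames.
Context (R : realType) (n : nat) (H1 H2 : lmodType R[i])
  (ip1 : nInnerProduct n H1) (ip2 : nInnerProduct n H2)
  (a : n.-1.-tuple H1) (b : n.-1.-tuple H2).

(* <f (x) g, f1 (x) g1 | a_2 (x) b_2, ..., a_n (x) b_n> *)
Definition tensor_ip (f : H1) (g : H2) (f1 : H1) (g1 : H2) : R[i] :=
  ip1 f f1 a * ip2 g g1 b.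

(* || f (x) g, a_2 (x) b_2, ..., a_n (x) b_n || *)
Definition tensor_norm (f : H1) (g : H2) : R := nnorm ip1 f a * nnorm ip2 g b.

Context (d1 d2 : measure_display)
  (X1 : measurableType d1) (X2 : measurableType d2)
  (mu : {measure set (X1 * X2) -> \bar R}).

Definition tensor_frame (F1 : X1 -> H1) (F2 : X2 -> H2) : Prop :=
  (forall f g, cmeasurable (fun x : X1 * X2 =>
     tensor_ip f g (F1 x.1) (F2 x.2))) /\
  exists A B : R, [/\ 0 < A, 0 < B &
    forall f g,
      let I := (\int[mu]_x
        ((Normc.normc (tensor_ip f g (F1 x.1) (F2 x.2))) ^+ 2)%:E)%E in
      ((A * (tensor_norm f g) ^+ 2)%:E <= I)%E /\
      (I <= (B * (tensor_norm f g) ^+ 2)%:E)%E].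

Context (HF HG T : lmodType R[i]) (dotT : {dot T for (@Num.conj R[i])})
  (iF : {linear H1 -> HF}) (iG : {linear H2 -> HG})
  (tens : {bilinear HF -> HG -> T}).

(* The image of the elementary tensor f (x) g in HF (x) HG. *)
Definition etens (f : H1) (g : H2) : T := tens (iF f) (iG g).

(* G1 (x) G2 is a dual continuous frame of F1 (x) F2. *)
Definition dual_tensor_frame (F1 : X1 -> H1) (F2 : X2 -> H2)
    (G1 : X1 -> H1) (G2 : X2 -> H2) : Prop :=
  [/\ tensor_frame F1 F2, tensor_frame G1 G2 &
      forall f g,
        weak_integral mu dotT
          (fun x : X1 * X2 =>
             tensor_ip f g (F1 x.1) (F2 x.2) *: etens (G1 x.1) (G2 x.2))
          (etens f g)].

End TensorFrames.

(* Main.v *)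
Require Import Defs.
From HB Require Import structures.
From mathcomp Require Import all_boot all_order all_algebra.
From mathcomp Require Import sesquilinear.
From mathcomp Require Import all_classical all_reals all_analysis.
From mathcomp Require Import complex.
From mathcomp Require Import ring lra.
From mathcomp Require Import measurable_realfun.

(** Everything happens in the Hilbert spaces HF and HG: since iota carries
  <x, y | a> to the inner product of HF and has dense range, a Bessel family
  in H1 becomes a Bessel family in HF, tested against all vectors of HF
  ([hbessel_completion]), and the reproducing formula becomes a weak integral
  in HF ([dual_pair_completion]).

  The frame inequalities only concern elementary tensors, where the integral
  over the product space factors by Tonelli ([L2sq_tensor]). Each factor is
  bounded above by the Bessel inequality. It is bounded below because the
  reproducing formula writes ||f||^2 as the integral of a product of a
  coefficient against F and a coefficient against G; by Cauchy-Schwarz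
  (here: Young's inequality) and the Bessel bound of G, the coefficients
  against F cannot be small ([L2sq_reproducing_ge]).

  The weak integral has to be tested against every h in the Hilbert space
  HF (x) HG, not only against elementary tensors. For h elementary the identity
  is Fubini's theorem ([cintegral_tensor]), and it extends linearly to finite
  sums. To pass to the closure the map h |-> <Phi (x) Psi, h> must be bounded
  into L^2, that is, the tensor product of two Bessel families must be a Bessel
  family on the whole of HF (x) HG ([hbessel_tensor]). For a finite sum of
  tensors u_k (x) e_k, Gram-Schmidt on the second factors makes the e_k
  orthogonal; integrating first over X2, then over X1, bounds the L^2 norm by
  the sum of the ||u_k||^2 ||e_k||^2, which is ||h||^2 up to the product of the
  two bounds. Measurability and the Bessel bound then pass to limits by Fatou's
  lemma ([hbessel_dense]), and so does the identity ([weak_integral_dense]). *)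

Set Implicit Arguments.
Unset Strict Implicit.
Unset Printing Implicit Defensive.

Import Order.TTheory GRing.Theory Num.Theory.
Import numFieldNormedType.Exports.

Local Open Scope classical_set_scope.
Local Open Scope ring_scope.

(** * Complex numbers *)

Section ComplexNumbers.
Context (R : realType).
Implicit Types z w : R[i].

Lemma normc_sq z :
  Normc.normc z ^+ 2 = complex.Re z ^+ 2 + complex.Im z ^+ 2.
Proof. by case: z => a b /=; rewrite sqr_sqrtr// addr_ge0 ?sqr_ge0. Qed.

Lemma normc_ge0 z : 0 <= Normc.normc z.
Proof. by case: z => a b /=; rewrite sqrtr_ge0. Qed.

Lemma normcJ_R z : Normc.normc z^* = Normc.normc z.
Proof. by case: z => a b /=; rewrite sqrrN. Qed.

Lemma Re_mulc z w : complex.Re (z * w) =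
  complex.Re z * complex.Re w - complex.Im z * complex.Im w.
Proof. by case: z; case: w. Qed.

Lemma Im_mulc z w : complex.Im (z * w) =
  complex.Re z * complex.Im w + complex.Im z * complex.Re w.
Proof. by case: z => a b; case: w => a' b' /=. Qed.

Lemma Re_conjc z : complex.Re z^* = complex.Re z. Proof. by case: z. Qed.
Lemma Im_conjc z : complex.Im z^* = - complex.Im z. Proof. by case: z. Qed.
Lemma Re_addc z w : complex.Re (z + w) = complex.Re z + complex.Re w.
Proof. by case: z; case: w. Qed.
Lemma Im_addc z w : complex.Im (z + w) = complex.Im z + complex.Im w.
Proof. by case: z; case: w. Qed.
Lemma Re_subc z w : complex.Re (z - w) = complex.Re z - complex.Re w.
Proof. by case: z; case: w. Qed.
Lemma Im_subc z w : complex.Im (z - w) = complex.Im z - complex.Im w.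
Proof. by case: z; case: w. Qed.

Lemma complex_ext z w : complex.Re z = complex.Re w ->
  complex.Im z = complex.Im w -> z = w.
Proof. by case: z => a b; case: w => c d /= -> ->. Qed.

Lemma normr_Re_le z : `|complex.Re z| <= Normc.normc z.
Proof.
rewrite -ler_sqr ?nnegrE ?normc_ge0// normc_sq real_normK ?num_real//.
by rewrite lerDl sqr_ge0.
Qed.

Lemma normr_Im_le z : `|complex.Im z| <= Normc.normc z.
Proof.
rewrite -ler_sqr ?nnegrE ?normc_ge0// normc_sq real_normK ?num_real//.
by rewrite lerDr sqr_ge0.
Qed.

Lemma normc_le_ReIm z : Normc.normc z <= `|complex.Re z| + `|complex.Im z|.
Proof.
rewrite -ler_sqr ?nnegrE ?normc_ge0 ?addr_ge0// normc_sq.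
rewrite -(real_normK (num_real (complex.Re z))).
rewrite -(real_normK (num_real (complex.Im z))) sqrrD lerD2r lerDl.
by rewrite mulrn_wge0// mulr_ge0.
Qed.

(** The free parameter [t] lets the integrated form replace Cauchy-Schwarz in
L^2 without dividing by norms that may vanish. *)
Lemma young_normc z w (t : R) : 0 < t -> Normc.normc (z * w) <=
  (t * Normc.normc z ^+ 2 + t^-1 * Normc.normc w ^+ 2) / 2.
Proof.
move=> t0; rewrite Normc.normcM.
move: (Normc.normc z) (Normc.normc w) => a b.
have : 0 <= t^-1 * (t * a - b) ^+ 2.
  by rewrite mulr_ge0 ?sqr_ge0// invr_ge0 ltW.
rewrite (_ : t^-1 * _ = t * a ^+ 2 + t^-1 * b ^+ 2 - 2 * (a * b)).
  lra.
by field; rewrite gt_eqF.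
Qed.

End ComplexNumbers.

(** * Cauchy-Schwarz and the norm of a complex inner product *)

Section SesquilinearForms.
Context (R : realType) (H : lmodType R[i]).
Variable dot : {dot H for (@Num.conj R[i])}.
Implicit Types u v : H.

Lemma dotC u v : dot u v = (dot v u)^*.
Proof. by rewrite hermC/= expr0 mul1r. Qed.

Lemma dot_real u : dot u u = (complex.Re (dot u u))%:C%C.
Proof. by apply/esym/RRe_real/ger0_real/dnorm_ge0. Qed.

Lemma Re_dot_ge0 u : 0 <= complex.Re (dot u u).
Proof. by rewrite -ler0c -dot_real dnorm_ge0. Qed.

Lemma hnorm_sq u : hnorm dot u ^+ 2 = complex.Re (dot u u).
Proof. by rewrite /hnorm sqr_sqrtr// Re_dot_ge0. Qed.

Lemma hnorm_ge0 u : 0 <= hnorm dot u.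
Proof. by rewrite sqrtr_ge0. Qed.

Lemma dotDd u v : dot u v = 0 -> dot (u + v) (u + v) = dot u u + dot v v.
Proof. by move=> uv; rewrite hnormDd. Qed.

Lemma dotBl_proj u v : dot (u - (dot u v / dot v v) *: v) v = 0.
Proof.
rewrite linearBl/= linearZl_LR/=.
have [->|v0] := eqVneq v 0; first by rewrite !linear0r subrr.
apply/eqP; rewrite subr_eq0 eq_sym; apply/eqP.
by apply: (@divfK R[i] (dot v v)); rewrite dnorm_eq0.
Qed.

(** From Pythagoras applied to the projection of u on v and its remainder. *)
Lemma dot_cauchy_schwarz u v :
  Normc.normc (dot u v) <= hnorm dot u * hnorm dot v.
Proof.
rewrite -ler_sqr ?nnegrE ?mulr_ge0 ?normc_ge0 ?hnorm_ge0//.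
rewrite exprMn !hnorm_sq -lecR.
have -> : (Normc.normc (dot u v) ^+ 2)%:C%C = `|dot u v| ^+ 2 :> R[i].
  by rewrite rmorphXn.
rewrite [leRHS]rmorphM /= -!dot_real.
have [->|v0] := eqVneq v 0; first
  by rewrite linear0r normr0 expr0n mulr_ge0 ?dnorm_ge0.
pose c := dot u v / dot v v; pose w := u - c *: v.
have wv : dot w (c *: v) = 0 by rewrite linearZr_LR/= dotBl_proj mulr0.
have -> : dot u u = dot w w + `|c| ^+ 2 * dot v v.
  by rewrite -dnormZ -dotDd// subrK.
rewrite mulrDl -[leLHS]add0r lerD ?mulr_ge0 ?dnorm_ge0//.
rewrite -mulrA -expr2 -[X in _ * X ^+ 2](ger0_norm (dnorm_ge0 dot v)) -exprMn.
by rewrite -normrM divfK// dnorm_eq0.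
Qed.

Lemma hnormD_le u v : hnorm dot (u + v) <= hnorm dot u + hnorm dot v.
Proof.
rewrite -ler_sqr ?nnegrE ?addr_ge0 ?hnorm_ge0// hnorm_sq.
rewrite linearDl/= !linearDr/= !Re_addc sqrrD !hnorm_sq.
have -> : complex.Re (dot v u) = complex.Re (dot u v) by rewrite dotC Re_conjc.
have := le_trans (ler_norm _)
  (le_trans (normr_Re_le _) (dot_cauchy_schwarz u v)).
lra.
Qed.

Lemma hnormN_R u : hnorm dot (- u) = hnorm dot u.
Proof. by rewrite /hnorm hnormN. Qed.

Lemma ler_dist_hnorm u v : `|hnorm dot u - hnorm dot v| <= hnorm dot (u - v).
Proof.
rewrite ler_norml; apply/andP; split.
  have := hnormD_le (v - u) u; rewrite subrK -opprB hnormN_R; lra.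
by have := hnormD_le (u - v) v; rewrite subrK; lra.
Qed.

End SesquilinearForms.

(** * Complex-valued measurable and square-integrable functions *)

Section ComplexFunctions.
Context (R : realType) (d : measure_display) (X : measurableType d).
Implicit Types f g : X -> R[i].

Lemma cmeasurable_cst (c : R[i]) : cmeasurable (fun=> c : R[i]) (X := X).
Proof. by split; exact: measurable_cst. Qed.

Lemma cmeasurableD f g :
  cmeasurable f -> cmeasurable g -> cmeasurable (fun x => f x + g x).
Proof.
move=> [f1 f2] [g1 g2]; split.
  by under eq_fun do rewrite Re_addc; exact: measurable_funD.
by under eq_fun do rewrite Im_addc; exact: measurable_funD.
Qed.

Lemma cmeasurableM f g :
  cmeasurable f -> cmeasurable g -> cmeasurable (fun x => f x * g x).
Proof.
move=> [f1 f2] [g1 g2]; split.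
  under eq_fun do rewrite Re_mulc.
  by apply: measurable_funB; apply: measurable_funM.
under eq_fun do rewrite Im_mulc.
by apply: measurable_funD; apply: measurable_funM.
Qed.

Lemma cmeasurableJ f : cmeasurable f -> cmeasurable (fun x => (f x)^*).
Proof.
move=> [f1 f2]; split; first by under eq_fun do rewrite Re_conjc.
under eq_fun do rewrite Im_conjc.
exact: measurable_funN.
Qed.

Lemma cmeasurable_sum (I : Type) (s : seq I) (f : I -> X -> R[i]) :
  (forall i, cmeasurable (f i)) -> cmeasurable (fun x => \sum_(i <- s) f i x).
Proof.
move=> mf; elim: s => [|i s IH].
  by under eq_fun do rewrite big_nil; exact: cmeasurable_cst.
by under eq_fun do rewrite big_cons; exact: cmeasurableD.
Qed.

Lemma cmeasurable_comp (d' : measure_display) (Y : measurableType d')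
    (p : Y -> X) f : measurable_fun setT p ->
  cmeasurable f -> cmeasurable (fun y => f (p y)).
Proof. move=> mp [f1 f2].
by split; [exact: (measurableT_comp f1 mp)|exact: (measurableT_comp f2 mp)].
Qed.

Lemma measurable_normc_sq f : cmeasurable f ->
  measurable_fun setT (fun x => (Normc.normc (f x) ^+ 2)%:E).
Proof.
move=> [f1 f2]; apply/measurable_EFinP.
under eq_fun do rewrite normc_sq.
by apply: measurable_funD; apply: measurable_funX.
Qed.

Lemma cmeasurable_cvg (h : nat -> X -> R[i]) f :
  (forall k, cmeasurable (h k)) ->
  (forall x, (fun k => Normc.normc (f x - h k x)) @ \oo --> (0 : R)) ->
  cmeasurable f.
Proof.
move=> mh hf.
have cvg_part (part : R[i] -> R) x :
    (forall z w, part (z - w) = part z - part w) ->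
    (forall z, `|part z| <= Normc.normc z) ->
    (fun k => part (h k x)) @ \oo --> part (f x).
  move=> partB part_le; apply/cvgrPdist_le => e e0.
  have /cvgrPdist_le/(_ _ e0) := hf x; apply: filterS => k.
  rewrite sub0r normrN ger0_norm ?normc_ge0//; apply: le_trans.
  by rewrite -partB part_le.
split.
- apply: (@measurable_fun_cvg _ _ _ _
    (fun k x => complex.Re (h k x))) => [k|x _]; first exact: (mh k).1.
  by apply: cvg_part; [exact: Re_subc|exact: normr_Re_le].
- apply: (@measurable_fun_cvg _ _ _ _
    (fun k x => complex.Im (h k x))) => [k|x _]; first exact: (mh k).2.
  by apply: cvg_part; [exact: Im_subc|exact: normr_Im_le].
Qed.

Context (mu : {measure set X -> \bar R}).

Definition L2sq f : \bar R := (\int[mu]_x (Normc.normc (f x) ^+ 2)%:E)%E.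

Lemma L2sq_ge0 f : (0 <= L2sq f)%E.
Proof. by apply: integral_ge0 => x _; rewrite lee_fin sqr_ge0. Qed.

Lemma cintegrableD f g : cintegrable mu f -> cintegrable mu g ->
  cintegrable mu (fun x => f x + g x).
Proof.
move=> [f1 f2] [g1 g2]; split.
  by under eq_fun do rewrite Re_addc EFinD; exact: integrableD.
by under eq_fun do rewrite Im_addc EFinD; exact: integrableD.
Qed.

Lemma cintegralD f g : cintegrable mu f -> cintegrable mu g ->
  cintegral mu (fun x => f x + g x) = cintegral mu f + cintegral mu g.
Proof.
move=> [f1 f2] [g1 g2]; apply: complex_ext; rewrite ?Re_addc ?Im_addc /=.
  by under eq_Rintegral do rewrite Re_addc; exact: RintegralD.
by under eq_Rintegral do rewrite Im_addc; exact: RintegralD.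
Qed.

Lemma cintegrable0 : cintegrable mu (fun=> 0).
Proof. by split; exact: integrable0. Qed.

Lemma cintegral0 : cintegral mu (fun=> 0) = 0.
Proof. by apply: complex_ext; rewrite /= /Rintegral integral0. Qed.

Lemma cintegralJ f : cintegrable mu f ->
  cintegral mu (fun x => (f x)^*) = (cintegral mu f)^*.
Proof.
move=> [_ intf]; apply: complex_ext.
  by rewrite Re_conjc; apply: eq_Rintegral => x _; rewrite Re_conjc.
rewrite Im_conjc -[RHS]mulN1r -RintegralZl//.
by apply: eq_Rintegral => x _; rewrite Im_conjc mulN1r.
Qed.

Lemma cintegrable_sum (I : Type) (s : seq I) (f : I -> X -> R[i]) :
  (forall i, cintegrable mu (f i)) ->
  cintegrable mu (fun x => \sum_(i <- s) f i x) /\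
  cintegral mu (fun x => \sum_(i <- s) f i x) =
    \sum_(i <- s) cintegral mu (f i).
Proof.
move=> intf; elim: s => [|i s [IH1 IH2]].
  rewrite big_nil; under eq_fun do rewrite big_nil.
  by split; [exact: cintegrable0|exact: cintegral0].
rewrite big_cons -IH2; under eq_fun do rewrite big_cons.
by split; [exact: cintegrableD|exact: cintegralD].
Qed.

Section ProductOfSquareIntegrable.
Variables (f g : X -> R[i]) (A B : R).
Hypotheses (mf : cmeasurable f) (mg : cmeasurable g).
Hypotheses (fA : (L2sq f <= A%:E)%E) (gB : (L2sq g <= B%:E)%E).

(* Young's pointwise upper bound of the modulus of [f x * g x]. *)
Let dom (t : R) x :=
  ((t / 2)%:E * (Normc.normc (f x) ^+ 2)%:E
   + (t^-1 / 2)%:E * (Normc.normc (g x) ^+ 2)%:E)%E.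

Let integrable_normc_sq h C : cmeasurable h -> (L2sq h <= C%:E)%E ->
  mu.-integrable setT (fun x => (Normc.normc (h x) ^+ 2)%:E).
Proof.
move=> mh hC; apply/integrableP; split; first exact: measurable_normc_sq.
apply: le_lt_trans (ltry C); apply: le_trans hC.
by under eq_integral do rewrite gee0_abs ?lee_fin ?sqr_ge0//.
Qed.

Let integrable_dom t : mu.-integrable setT (dom t).
Proof.
by apply: integrableD => //; apply: integrableZl => //;
  [exact: integrable_normc_sq mf fA|exact: integrable_normc_sq mg gB].
Qed.

Let dom_bound (part : R[i] -> R) t x : (forall z, `|part z| <= Normc.normc z) ->
  0 < t -> (`|(part (f x * g x))%:E| <= dom t x)%E.
Proof.
move=> part_le t0; rewrite /dom -!EFinM -EFinD abse_EFin lee_fin.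
apply: le_trans (part_le _) _; apply: le_trans (young_normc _ _ t0) _.
lra.
Qed.

Let integrable_part (part : R[i] -> R) :
  (forall z, `|part z| <= Normc.normc z) ->
  measurable_fun setT (fun x => part (f x * g x)) ->
  mu.-integrable setT (fun x => (part (f x * g x))%:E).
Proof.
move=> part_le mpart; apply: (@le_integrable _ _ _ _ _ _ _ (dom 1)) => //.
  exact/measurable_EFinP.
move=> x _; apply: le_trans (dom_bound x part_le ltr01) _.
exact: lee_abs.
Qed.

Lemma cintegrableM : cintegrable mu (fun x => f x * g x).
Proof.
have [m1 m2] := cmeasurableM mf mg; split.
  by apply: integrable_part => // z; exact: normr_Re_le.
by apply: integrable_part => // z; exact: normr_Im_le.
Qed.

Let Rintegral_part_le (part : R[i] -> R) t :
  (forall z, `|part z| <= Normc.normc z) ->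
  measurable_fun setT (fun x => part (f x * g x)) -> 0 < t ->
  `|Rintegral mu setT (fun x => part (f x * g x))| <= (t * A + t^-1 * B) / 2.
Proof.
move=> part_le mpart t0; rewrite -lee_fin.
rewrite EFin_normr_Rintegral//; last exact: integrable_part.
apply: le_trans (le_abse_integral _ _ _) _ => //; first exact/measurable_EFinP.
have hs (C D : R) h : 0 < C -> cmeasurable h -> (L2sq h <= D%:E)%E ->
    (\int[mu]_x ((C / 2)%:E * (Normc.normc (h x) ^+ 2)%:E) <= (C * D / 2)%:E)%E.
  move=> C0 mh hD; rewrite ge0_integralZl_EFin//; last 3 first.
  - by move=> x _; rewrite lee_fin sqr_ge0.
  - exact: measurable_normc_sq.
  - by rewrite divr_ge0// ltW.
  rewrite mulrAC EFinM; apply: lee_wpmul2l hD.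
  by rewrite lee_fin divr_ge0// ltW.
apply: (@le_trans _ _ (\int[mu]_x dom t x)%E).
  apply: ge0_le_integral => //.
  - by apply: measurableT_comp => //; exact/measurable_EFinP.
  - exact: measurable_int (integrable_dom t).
  - by move=> x _; exact: dom_bound.
rewrite /dom ge0_integralD//; last 4 first.
- by move=> x _; rewrite -EFinM lee_fin mulr_ge0 ?sqr_ge0 ?divr_ge0// ltW.
- by apply: measurable_funeM; exact: measurable_normc_sq.
- by move=> x _; rewrite -EFinM lee_fin mulr_ge0 ?sqr_ge0 ?divr_ge0
    ?invr_ge0// ltW.
- by apply: measurable_funeM; exact: measurable_normc_sq.
rewrite mulrDl EFinD; apply: leeD; apply: hs => //.
by rewrite invr_gt0.
Qed.

(** Young's inequality integrated on the real and the imaginary part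
separately; adding the two cancels its factor 1/2. *)
Lemma normc_cintegralM_le t : 0 < t ->
  Normc.normc (cintegral mu (fun x => f x * g x)) <= t * A + t^-1 * B.
Proof.
move=> t0; have [m1 m2] := cmeasurableM mf mg.
apply: le_trans (normc_le_ReIm _) _ => /=.
have := Rintegral_part_le (@normr_Re_le R) m1 t0.
have := Rintegral_part_le (@normr_Im_le R) m2 t0.
lra.
Qed.

End ProductOfSquareIntegrable.

(** Fatou's lemma: a pointwise limit keeps the limit of the bounds. *)
Lemma L2sq_cvg_le (h : nat -> X -> R[i]) f (c : nat -> R) (C : R) :
  (forall k, cmeasurable (h k)) ->
  (forall x, (fun k => Normc.normc (f x - h k x)) @ \oo --> (0 : R)) ->
  (forall k, (L2sq (h k) <= (c k)%:E)%E) -> c @ \oo --> C ->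
  (L2sq f <= C%:E)%E.
Proof.
move=> mh hf hc cC.
have cvg_sq x : (fun k => (Normc.normc (h k x) ^+ 2)%:E) @ \oo -->
    (Normc.normc (f x) ^+ 2)%:E.
  apply/cvg_EFin; first by near=> k.
  under eq_fun do rewrite expr2.
  suff cvg_h : (fun k => Normc.normc (h k x)) @ \oo --> Normc.normc (f x).
    by rewrite expr2; apply: cvgM.
  apply/cvgrPdist_le => e e0; have /cvgrPdist_le/(_ _ e0) := hf x.
  apply: filterS => k; rewrite sub0r normrN ger0_norm ?normc_ge0//.
  apply: le_trans; rewrite ler_norml; apply/andP; split.
    have := le_normcD (h k x - f x) (f x).
    by rewrite subrK -[in Normc.normc (h k x - f x)]opprB normcN; lra.
  by have := le_normcD (f x - h k x) (h k x); rewrite subrK; lra.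
have -> : L2sq f = (\int[mu]_x limn_einf
    (fun k => (Normc.normc (h k x) ^+ 2)%:E))%E.
  apply: eq_integral => x _; rewrite is_cvg_limn_einfE.
    by apply/esym/cvg_lim => //; exact: cvg_sq.
  by apply/cvg_ex; eexists; exact: cvg_sq.
apply: le_trans (fatou _ _ _ _) _ => //.
- by move=> k; exact: measurable_normc_sq.
- by move=> k x _; rewrite lee_fin sqr_ge0.
have cvg_c : (fun k => (c k)%:E) @ \oo --> C%:E.
  by apply/cvg_EFin => //; near=> k.
rewrite limn_einf_lim -(cvg_lim _ cvg_c)//.
apply: lee_lim; [exact: is_cvg_einfs|by apply/cvg_ex; eexists; exact: cvg_c|].
near=> k; apply: le_trans (hc k); apply: ereal_inf_lbound.
by exists k => /=.
Unshelve. all: by end_near. Qed.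

End ComplexFunctions.

(** * Bessel families in a Hilbert space *)

Section HilbertBessel.
Context (R : realType) (H : lmodType R[i]) (dot : {dot H for (@Num.conj R[i])}).
Context (d : measure_display) (X : measurableType d).
Context (mu : {measure set X -> \bar R}).
Implicit Types (Phi : X -> H) (P : H -> Prop).

Definition hdense P := forall (u : H) (eps : R), 0 < eps ->
  exists2 v, P v & hnorm dot (u - v) < eps.

(** The Bessel condition tested only against the vectors in P: the form in which
it is known before passing to a completion. *)
Definition hbessel_on P Phi (C : R) :=
  (forall u, P u -> cmeasurable (fun x => dot u (Phi x))) /\
  (forall u, P u ->
     (L2sq mu (fun x => dot u (Phi x)) <= (C * hnorm dot u ^+ 2)%:E)%E).

Definition hbessel := hbessel_on (fun=> True).

Lemma hdense_seq P u : hdense P -> exists2 v : nat -> H,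
  (forall k, P (v k)) & (fun k => hnorm dot (u - v k)) @ \oo --> (0 : R).
Proof.
move=> dP; have /choice[v hv] : forall k : nat, exists v,
    P v /\ hnorm dot (u - v) < k.+1%:R^-1.
  by move=> k; have [|v Pv uv] := dP u k.+1%:R^-1; [rewrite invr_gt0|exists v].
exists v => [k|]; first by have [] := hv k.
apply: (@squeeze_cvgr _ _ _ _ (fun=> 0) harmonic).
- by near=> k; rewrite hnorm_ge0/= ltW//; have [] := hv k.
- exact: cvg_cst.
- exact: cvg_harmonic.
Unshelve. all: by end_near. Qed.

(** Cauchy-Schwarz makes x |-> <u, Phi x> the pointwise limit of the same
coefficients of approximations of u in P, so measurability passes to the limit
and Fatou's lemma transports the bound. *)
Lemma hbessel_dense P Phi C : hdense P -> hbessel_on P Phi C -> hbessel Phi C.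
Proof.
move=> dP [mP leP].
have approx u : exists v : nat -> H, [/\ forall k, P (v k),
    (fun k => hnorm dot (u - v k)) @ \oo --> (0 : R) &
    forall x, (fun k => Normc.normc (dot u (Phi x) - dot (v k) (Phi x)))
                @ \oo --> (0 : R)].
  have [v Pv uv] := hdense_seq u dP; exists v; split => // x.
  apply: (@squeeze_cvgr _ _ _ _ (fun=> 0)
    (fun k => hnorm dot (u - v k) * hnorm dot (Phi x))).
  - near=> k; rewrite normc_ge0/=.
    by rewrite -linearBl; exact: dot_cauchy_schwarz.
  - exact: cvg_cst.
  - by rewrite -[X in _ --> X](mul0r (hnorm dot (Phi x))); apply: cvgMl.
split=> u _; have [v [Pv uv uvx]] := approx u.
  by apply: (@cmeasurable_cvg _ _ _ (fun k x => dot (v k) (Phi x))) => // k;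
    exact: mP.
apply: (@L2sq_cvg_le _ _ _ _ (fun k x => dot (v k) (Phi x)) _
  (fun k => C * hnorm dot (v k) ^+ 2)) => //.
- by move=> k; exact: mP.
- by move=> k; exact: leP.
apply: cvgMr; rewrite expr2; under eq_fun do rewrite expr2.
suff cvg_n : (fun k => hnorm dot (v k)) @ \oo --> hnorm dot u by apply: cvgM.
apply/cvgrPdist_le => e e0; have /cvgrPdist_le/(_ _ e0) := uv.
apply: filterS => k; rewrite sub0r normrN ger0_norm ?hnorm_ge0//.
by apply: le_trans; exact: ler_dist_hnorm.
Unshelve. all: by end_near. Qed.

Lemma cmeasurable_dotr Phi C h : hbessel Phi C ->
  cmeasurable (fun x => dot (Phi x) h).
Proof.
move=> [mPhi _]; under eq_fun do rewrite dotC.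
by apply: cmeasurableJ; exact: mPhi.
Qed.

Lemma L2sq_dotr_le Phi C h : hbessel Phi C ->
  (L2sq mu (fun x => dot (Phi x) h) <= (C * hnorm dot h ^+ 2)%:E)%E.
Proof.
move=> [_ /(_ h I)]; congr (_ <= _)%E.
by apply: eq_integral => x _; rewrite [dot (Phi x) h]dotC normcJ_R.
Qed.

(** Both sides of the identity are continuous in h: the left one by
Cauchy-Schwarz, the right one because p is square-integrable and the Bessel
bound makes h |-> <Phi, h> bounded into L^2. *)
Lemma weak_integral_dense (p : X -> R[i]) (A : R) P Phi C v :
  cmeasurable p -> (L2sq mu p <= A%:E)%E -> hbessel Phi C -> hdense P ->
  (forall h, P h -> dot v h = cintegral mu (fun x => p x * dot (Phi x) h)) ->
  weak_integral mu dot (fun x => p x *: Phi x) v.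
Proof.
move=> mp pA bPhi dP Pv h.
have scaleE g : (fun x => dot (p x *: Phi x) g) =
    (fun x => p x * dot (Phi x) g).
  by apply/funext => x; rewrite linearZl_LR.
rewrite scaleE.
have int g : cintegrable mu (fun x => p x * dot (Phi x) g).
  by apply: cintegrableM pA (L2sq_dotr_le g bPhi) => //;
    exact: cmeasurable_dotr bPhi.
split=> //; set J := cintegral _ _.
have dist_le (e : R) : 0 < e ->
    Normc.normc (dot v h - J) <= (hnorm dot v + A + `|C|) * e.
  move=> e0; have [g Pg hg] := dP h e e0.
  have split_v : dot v h = dot v (h - g) + dot v g.
    by rewrite -linearDr subrK.
  have split_J : J = cintegral mu (fun x => p x * dot (Phi x) (h - g)) +
                cintegral mu (fun x => p x * dot (Phi x) g).
    rewrite -cintegralD//; congr (cintegral mu _); apply/funext => x.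
    by rewrite -mulrDr -linearDr subrK.
  rewrite split_v split_J -(Pv g Pg) opprD addrACA subrr addr0.
  apply: le_trans (le_normcD _ _) _; rewrite normcN.
  have hg2 : C * hnorm dot (h - g) ^+ 2 <= `|C| * e ^+ 2.
    apply: (@le_trans _ _ (`|C| * hnorm dot (h - g) ^+ 2)).
      by rewrite ler_wpM2r ?sqr_ge0 ?ler_norm.
    by rewrite ler_wpM2l// ler_sqr ?nnegrE ?hnorm_ge0 ?ltW.
  have bound_hg : (L2sq mu (fun x => dot (Phi x) (h - g)%R) <=
      (`|C| * e ^+ 2)%:E)%E.
    by apply: le_trans (L2sq_dotr_le (h - g) bPhi) _; rewrite lee_fin.
  (* Young's parameter is taken to be e, so that both terms are linear in e. *)
  have := normc_cintegralM_le mp (cmeasurable_dotr (h - g) bPhi) pA bound_hg e0.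
  have -> : e * A + e^-1 * (`|C| * e ^+ 2) = (A + `|C|) * e.
    by field; rewrite gt_eqF.
  have := dot_cauchy_schwarz dot v (h - g).
  have : hnorm dot v * hnorm dot (h - g) <= hnorm dot v * e.
    by rewrite ler_wpM2l ?hnorm_ge0// ltW.
  lra.
apply/eqP; rewrite -subr_eq0; apply/eqP/Normc.eq0_normc/eqP.
rewrite eq_le normc_ge0 andbT leNgt; apply/negP => z0.
(* A positive majorant of the constant, so that one can divide by it. *)
pose K := `|hnorm dot v + A + `|C| | + 1.
have K0 : 0 < K by rewrite ltr_wpDl.
have e0 : 0 < Normc.normc (dot v h - J) / (2 * K).
  by rewrite divr_gt0// mulr_gt0.
have := dist_le _ e0; apply/negP; rewrite -ltNge.
apply: (@le_lt_trans _ _ (K * (Normc.normc (dot v h - J) / (2 * K)))).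
  rewrite ler_wpM2r ?(ltW e0)//.
  by apply: le_trans (ler_norm _) _; rewrite lerDl.
have -> : K * (Normc.normc (dot v h - J) / (2 * K)) =
    Normc.normc (dot v h - J) / 2 by field; rewrite gt_eqF.
lra.
Qed.

(** Young's inequality with t = 2C bounds ||u||^2 by 2C times the right-hand
side plus ||u||^2 / 2, the second term coming from the Bessel bound of Psi; it
is absorbed on the left, whence the constant 1 / (4C). *)
Lemma L2sq_reproducing_ge (Phi Psi : X -> H) (B C : R) u : 0 < C ->
  hbessel Phi B -> hbessel Psi C ->
  dot u u = cintegral mu (fun x => dot u (Phi x) * dot (Psi x) u) ->
  (((4 * C)^-1 * hnorm dot u ^+ 2)%:E <= L2sq mu (fun x => dot u (Phi x)))%E.
Proof.
move=> C0 bPhi bPsi uE; set L := L2sq _ _.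
have L_fin : L \is a fin_num.
  rewrite fin_numElt (lt_le_trans (ltNyr 0) (L2sq_ge0 _ _))/=.
  by apply: le_lt_trans (ltry (B * hnorm dot u ^+ 2)); exact: bPhi.2.
have L_le : (L <= (fine L)%:E)%E by rewrite fineK.
rewrite -(fineK L_fin) lee_fin.
have t0 : 0 < 2 * C by rewrite mulr_gt0.
have := normc_cintegralM_le (bPhi.1 u I) (cmeasurable_dotr u bPsi) L_le
  (L2sq_dotr_le u bPsi) t0.
rewrite -uE => le1.
have := le_trans (le_trans (ler_norm _) (normr_Re_le (dot u u))) le1.
rewrite -hnorm_sq.
have -> : (2 * C)^-1 * (C * hnorm dot u ^+ 2) = hnorm dot u ^+ 2 / 2.
  by field; rewrite gt_eqF.
move=> le2; rewrite mulrC ler_pdivrMr ?mulr_gt0//.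
lra.
Qed.

End HilbertBessel.

(** * Elementary tensors on a product of measure spaces *)

Section ProductMeasure.
Context (R : realType) (d1 d2 : measure_display).
Context (X1 : measurableType d1) (X2 : measurableType d2).
Context (mu1 : {sigma_finite_measure set X1 -> \bar R}).
Context (mu2 : {sigma_finite_measure set X2 -> \bar R}).

Lemma cmeasurable_tensor (f : X1 -> R[i]) (g : X2 -> R[i]) :
  cmeasurable f -> cmeasurable g ->
  cmeasurable (fun x : X1 * X2 => f x.1 * g x.2).
Proof.
move=> mf mg; apply: cmeasurableM.
  exact: (cmeasurable_comp measurable_fst mf).
exact: (cmeasurable_comp measurable_snd mg).
Qed.

Lemma L2sq_tensor (f : X1 -> R[i]) (g : X2 -> R[i]) :
  cmeasurable f -> cmeasurable g ->
  L2sq (mu1 \x mu2)%E (fun x => f x.1 * g x.2) = (L2sq mu1 f * L2sq mu2 g)%E.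
Proof.
move=> mf mg; rewrite /L2sq fubini_tonelli1; last 2 first.
- exact/measurable_normc_sq/cmeasurable_tensor.
- by move=> x; rewrite lee_fin sqr_ge0.
rewrite /fubini_F /=.
under eq_integral => x _.
  under eq_integral do rewrite Normc.normcM exprMn EFinM.
  rewrite ge0_integralZl_EFin ?sqr_ge0//; last 2 first.
  - by move=> y _; rewrite lee_fin sqr_ge0.
  - exact: measurable_normc_sq.
  over.
rewrite ge0_integralZr//; first exact: measurable_normc_sq.
- by move=> x _; rewrite lee_fin sqr_ge0.
- exact: (L2sq_ge0 mu2 g).
Qed.

Lemma Rintegral_tensor (f : X1 -> R) (g : X2 -> R) :
  mu1.-integrable setT (EFin \o f) -> mu2.-integrable setT (EFin \o g) ->
  (mu1 \x mu2)%E.-integrable setT (fun x : X1 * X2 => (f x.1 * g x.2)%:E) /\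
  Rintegral (mu1 \x mu2)%E setT (fun x : X1 * X2 => f x.1 * g x.2) =
    Rintegral mu1 setT f * Rintegral mu2 setT g.
Proof.
move=> intf intg.
have /measurable_EFinP mf := measurable_int _ intf.
have /measurable_EFinP mg := measurable_int _ intg.
have mfg : measurable_fun setT (fun x : X1 * X2 => (f x.1 * g x.2)%:E).
  apply/measurable_EFinP; apply: measurable_funM.
    exact: (measurableT_comp mf measurable_fst).
  exact: (measurableT_comp mg measurable_snd).
have intfg : (mu1 \x mu2)%E.-integrable setT
    (fun x : X1 * X2 => (f x.1 * g x.2)%:E).
  apply/integrable12ltyP => //.
  under eq_integral => x _.
    under eq_integral do rewrite /= normrM EFinM.
    rewrite ge0_integralZl_EFin//; last first.
      by apply/measurable_EFinP; exact: measurableT_comp mg.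
    over.
  rewrite ge0_integralZr//; last 2 first.
  - by apply/measurable_EFinP; exact: measurableT_comp mf.
  - exact: integral_ge0.
  have /integrableP[_ f_lty] := intf; have /integrableP[_ g_lty] := intg.
  by apply: lte_mul_pinfty => //; [exact: integral_ge0|
    rewrite ge0_fin_numE//; exact: integral_ge0].
split=> //; rewrite {1}/Rintegral -integral12_prod_meas1// /fubini_F/=.
under eq_integral => x _.
  under eq_integral do rewrite EFinM.
  rewrite integralZl// -(fineK (integrable_fin_num measurableT intg)).
  over.
rewrite integralZr// fineM//; exact: integrable_fin_num.
Qed.

Lemma cintegral_tensor (f : X1 -> R[i]) (g : X2 -> R[i]) :
  cintegrable mu1 f -> cintegrable mu2 g ->
  cintegrable (mu1 \x mu2)%E (fun x : X1 * X2 => f x.1 * g x.2) /\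
  cintegral (mu1 \x mu2)%E (fun x : X1 * X2 => f x.1 * g x.2) =
    cintegral mu1 f * cintegral mu2 g.
Proof.
move=> [f1 f2] [g1 g2].
have [irr rr] := Rintegral_tensor f1 g1.
have [iri ri] := Rintegral_tensor f1 g2.
have [iir ir] := Rintegral_tensor f2 g1.
have [iii ii] := Rintegral_tensor f2 g2.
split.
  split.
    by under eq_fun do rewrite Re_mulc EFinB; exact: integrableB.
  by under eq_fun do rewrite Im_mulc EFinD; exact: integrableD.
apply: complex_ext; rewrite ?Re_mulc ?Im_mulc.
  transitivity (Rintegral (mu1 \x mu2)%E setT (fun x : X1 * X2 =>
    complex.Re (f x.1) * complex.Re (g x.2)
    - complex.Im (f x.1) * complex.Im (g x.2))).
    by apply: eq_Rintegral => x _; exact: Re_mulc.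
  by rewrite RintegralB// rr ii.
transitivity (Rintegral (mu1 \x mu2)%E setT (fun x : X1 * X2 =>
  complex.Re (f x.1) * complex.Im (g x.2)
  + complex.Im (f x.1) * complex.Re (g x.2))).
  by apply: eq_Rintegral => x _; exact: Im_mulc.
by rewrite RintegralD// ri ir.
Qed.

End ProductMeasure.

(** * Bessel families in a Hilbert tensor product *)

Section Pythagoras.
Context (R : realType) (H : lmodType R[i]) (dot : {dot H for (@Num.conj R[i])}).

Lemma hnormZ_sq (a : R[i]) (u : H) :
  hnorm dot (a *: u) ^+ 2 = Normc.normc a ^+ 2 * hnorm dot u ^+ 2.
Proof.
apply: complexI; rewrite [RHS]rmorphM /= !hnorm_sq -!dot_real.
by rewrite dnormZ; congr (_ * _); rewrite rmorphXn.
Qed.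

Lemma pythagoras (I : Type) (s : seq I) (e : I -> H) :
  pairwise (fun i j => dot (e i) (e j) == 0) s ->
  hnorm dot (\sum_(i <- s) e i) ^+ 2 = \sum_(i <- s) hnorm dot (e i) ^+ 2.
Proof.
elim: s => [|i s IH]; first by rewrite !big_nil hnorm_sq linear0l.
rewrite pairwise_cons !big_cons => /andP[orth_i /IH <-].
rewrite !hnorm_sq dotDd ?Re_addc// linear_sumr.
elim: s orth_i {IH} => [|j s IH] /=; first by rewrite big_nil.
by rewrite big_cons => /andP[/eqP-> /IH ->]; rewrite addr0.
Qed.

End Pythagoras.

Section TensorProduct.
Context (R : realType) (HF HG T : lmodType R[i]).
Context (dotF : {dot HF for (@Num.conj R[i])}).
Context (dotG : {dot HG for (@Num.conj R[i])}).
Context (dotT : {dot T for (@Num.conj R[i])}).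
Context (tens : {bilinear HF -> HG -> T}).
Implicit Types s : seq (HF * HG).

Definition tsum s : T := \sum_(p <- s) tens p.1 p.2.

Let orthG := [rel v w : HG | dotG v w == 0].

(* v' is v minus its projections on the second factors of s; what is removed
from v is moved to the first factors, which leaves the tensor unchanged. *)
Let orthogonalize_one s u v : pairwise orthG (map snd s) ->
  exists s' v', [/\ tsum s' + tens u v' = tsum s + tens u v,
    map snd s' = map snd s & all (orthG v') (map snd s)].
Proof.
elim: s => [|q s IH]; first by exists [::], v.
rewrite /= => /andP[q_s /IH[s' [v' [sumE sndE v'_s]]]].
pose c := dotG v' q.2 / dotG q.2 q.2.
exists ((q.1 + c *: u, q.2) :: s'), (v' - c *: q.2); split.
- rewrite /tsum !big_cons -/(tsum s) -/(tsum s') /=.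
  rewrite linearDl/= linearBr/= linearZl_LR/= linearZr_LR/=.
  rewrite -[RHS]addrA -sumE -!addrA; congr (_ + _).
  by rewrite addrCA; congr (_ + _); rewrite addrCA subrr addr0.
- by rewrite /= sndE.
- rewrite /= dotBl_proj eqxx/=; elim: (map snd s) q_s v'_s => //= w r IHr.
  move=> /andP[/eqP qw qr] /andP[/eqP vw vr]; rewrite IHr// andbT.
  by rewrite linearBl/= linearZl_LR/= vw qw mulr0 subr0.
Qed.

(** Gram-Schmidt on the second factors; the resulting orthogonal vectors are not
normalized and some of them may vanish. *)
Lemma tsum_orthogonal s : exists2 s',
  tsum s' = tsum s & pairwise (fun p q => dotG p.2 q.2 == 0) s'.
Proof.
suff [s' sE s'_orth] : exists2 s',
    tsum s' = tsum s & pairwise orthG (map snd s').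
  by exists s' => //; rewrite pairwise_map in s'_orth.
elim: s => [|[u v] s [s1 sE s1_orth]]; first by exists [::].
have [s2 [v' [sumE sndE v'_s]]] := orthogonalize_one u v s1_orth.
exists ((u, v') :: s2); last by rewrite /= sndE v'_s s1_orth.
by rewrite /tsum !big_cons -/(tsum s) -/(tsum s2) /= addrC sumE sE addrC.
Qed.

Hypothesis tensP : hilbert_tensor dotF dotG dotT tens.

Lemma hdense_tsum : hdense dotT (fun t => exists s, t = tsum s).
Proof.
move=> t e e0; have [m [u [v h]]] := ht_dense tensP t e0.
exists (\sum_(i < m) tens (u i) (v i)) => //.
by exists [seq (u i, v i) | i <- enum 'I_m]; rewrite /tsum big_map big_enum.
Qed.

Context (d1 d2 : measure_display).
Context (X1 : measurableType d1) (X2 : measurableType d2).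
Context (mu1 : {sigma_finite_measure set X1 -> \bar R}).
Context (mu2 : {sigma_finite_measure set X2 -> \bar R}).

(** With orthogonal second factors e_k, for fixed x1 the coefficient is
the one of the vector with coordinates <u_k, Phi x1> along the e_k. The Bessel
bound of Psi and Pythagoras reduce the integral over X2 to
C times the sum of the |<u_k, Phi x1>|^2 ||e_k||^2, and the Bessel bound of Phi
finishes. *)
Lemma hbessel_tensor (Phi : X1 -> HF) (Psi : X2 -> HG) (B C : R) : 0 <= C ->
  hbessel dotF mu1 Phi B -> hbessel dotG mu2 Psi C ->
  hbessel dotT (mu1 \x mu2)%E (fun x => tens (Phi x.1) (Psi x.2)) (B * C).
Proof.
move=> C0 [mPhi bPhi] [mPsi bPsi]; apply: hbessel_dense hdense_tsum _.
have coefE s x : dotT (tsum s) (tens (Phi x.1) (Psi x.2)) =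
    \sum_(p <- s) dotF p.1 (Phi x.1) * dotG p.2 (Psi x.2).
  by rewrite linear_sumlz; apply: eq_bigr => p _; rewrite /= (ht_dot tensP).
have mcoef s : cmeasurable (fun x : X1 * X2 =>
    dotT (tsum s) (tens (Phi x.1) (Psi x.2))).
  under eq_fun do rewrite coefE; apply: cmeasurable_sum => p.
  exact: (cmeasurable_tensor (mPhi p.1 I) (mPsi p.2 I)).
split=> _ [s ->]; first exact: mcoef.
have [{}s <- s_orth] := tsum_orthogonal s.
have normE : hnorm dotT (tsum s) ^+ 2 =
    \sum_(p <- s) hnorm dotF p.1 ^+ 2 * hnorm dotG p.2 ^+ 2.
  rewrite pythagoras; last first.
    apply: sub_pairwise s_orth => p q /eqP pq.
    by rewrite /= (ht_dot tensP) pq mulr0.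
  apply: eq_bigr => p _; apply: complexI; rewrite [RHS]rmorphM /= !hnorm_sq.
  by rewrite -!dot_real (ht_dot tensP).
have inner_le x1 : (L2sq mu2 (fun x2 =>
      dotT (tsum s) (tens (Phi x1) (Psi x2))) <=
    \sum_(p <- s) (C * hnorm dotG p.2 ^+ 2)%:E *
      (Normc.normc (dotF p.1 (Phi x1)) ^+ 2)%:E)%E.
  pose w := \sum_(p <- s) dotF p.1 (Phi x1) *: p.2.
  have -> : (fun x2 => dotT (tsum s) (tens (Phi x1) (Psi x2))) =
      (fun x2 => dotG w (Psi x2)).
    apply/funext => x2; rewrite (coefE s (x1, x2)) linear_sumlz.
    by apply: eq_bigr => p _; rewrite linearZl_LR.
  apply: le_trans (bPsi w I) _; rewrite pythagoras; last first.
    apply: sub_pairwise s_orth => p q /eqP pq.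
    by rewrite /= linearZl_LR linearZr_LR/= pq !mulr0.
  rewrite mulr_sumr sumEFin lee_fin; apply: ler_sum => p _.
  by rewrite hnormZ_sq mulrCA mulrC.
rewrite /L2sq fubini_tonelli1; last 2 first.
- exact/measurable_normc_sq/mcoef.
- by move=> x; rewrite lee_fin sqr_ge0.
have mterm (p : HF * HG) : measurable_fun setT (fun x1 =>
    (C * hnorm dotG p.2 ^+ 2)%:E * (Normc.normc (dotF p.1 (Phi x1)) ^+ 2)%:E)%E.
  by apply: measurable_funeM; apply: measurable_normc_sq; exact: mPhi.
have term_ge0 (p : HF * HG) x1 : (0 <=
    (C * hnorm dotG p.2 ^+ 2)%:E * (Normc.normc (dotF p.1 (Phi x1)) ^+ 2)%:E)%E.
  by rewrite -EFinM lee_fin mulr_ge0 ?sqr_ge0// mulr_ge0 ?sqr_ge0.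
apply: (@le_trans _ _ (\int[mu1]_x1 \sum_(p <- s)
  (C * hnorm dotG p.2 ^+ 2)%:E * (Normc.normc (dotF p.1 (Phi x1)) ^+ 2)%:E)%E).
  apply: ge0_le_integral => //.
  - by move=> x1 _; apply: integral_ge0 => x2 _; rewrite lee_fin sqr_ge0.
  - apply: measurable_fun_fubini_tonelli_F.
    + exact/measurable_normc_sq/mcoef.
    + by move=> x; rewrite lee_fin sqr_ge0.
  - exact: emeasurable_sum.
  - by move=> x1 _; exact: inner_le.
rewrite ge0_integral_sum// normE mulr_sumr -sumEFin.
apply: lee_sum => p _; rewrite ge0_integralZl_EFin//; last 3 first.
- by move=> x _; rewrite lee_fin sqr_ge0.
- by apply: measurable_normc_sq; exact: mPhi.
- by rewrite mulr_ge0 ?sqr_ge0.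
have -> : B * C * (hnorm dotF p.1 ^+ 2 * hnorm dotG p.2 ^+ 2) =
    (C * hnorm dotG p.2 ^+ 2) * (B * hnorm dotF p.1 ^+ 2) by ring.
rewrite EFinM; apply: lee_wpmul2l (bPhi p.1 I).
by rewrite lee_fin mulr_ge0 ?sqr_ge0.
Qed.

(** Against a finite sum of elementary tensors this is Fubini's theorem. *)
Lemma weak_integral_tensor (Phi1 Psi1 : X1 -> HF) (Phi2 Psi2 : X2 -> HG)
    (B1 C1 B2 C2 : R) f g : 0 <= C2 ->
  hbessel dotF mu1 Phi1 B1 -> hbessel dotF mu1 Psi1 C1 ->
  hbessel dotG mu2 Phi2 B2 -> hbessel dotG mu2 Psi2 C2 ->
  weak_integral mu1 dotF (fun x => dotF f (Phi1 x) *: Psi1 x) f ->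
  weak_integral mu2 dotG (fun x => dotG g (Phi2 x) *: Psi2 x) g ->
  weak_integral (mu1 \x mu2)%E dotT
    (fun x => (dotF f (Phi1 x.1) * dotG g (Phi2 x.2))
                *: tens (Psi1 x.1) (Psi2 x.2)) (tens f g).
Proof.
move=> C20 bPhi1 bPsi1 bPhi2 bPsi2 wf wg.
have mf := bPhi1.1 f I; have mg := bPhi2.1 g I.
apply: (@weak_integral_dense _ _ _ _ _ _
  (fun x : X1 * X2 => dotF f (Phi1 x.1) * dotG g (Phi2 x.2))
  ((B1 * hnorm dotF f ^+ 2) * (B2 * hnorm dotG g ^+ 2))
  (fun t => exists s, t = tsum s) (fun x => tens (Psi1 x.1) (Psi2 x.2))
  (C1 * C2)).
- exact: (cmeasurable_tensor mf mg).
- rewrite (L2sq_tensor mu1 mu2 mf mg) EFinM; apply: lee_pmul; rewrite ?L2sq_ge0//.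
    exact: (bPhi1.2 f I).
  exact: (bPhi2.2 g I).
- exact: (hbessel_tensor C20 bPsi1 bPsi2).
- exact: hdense_tsum.
move=> _ [s ->]; rewrite linear_sumr.
have -> : (fun x : X1 * X2 => dotF f (Phi1 x.1) * dotG g (Phi2 x.2) *
      dotT (tens (Psi1 x.1) (Psi2 x.2)) (tsum s)) =
    (fun x => \sum_(p <- s)
      dotF (dotF f (Phi1 x.1) *: Psi1 x.1) p.1 *
      dotG (dotG g (Phi2 x.2) *: Psi2 x.2) p.2).
  apply/funext => x; rewrite linear_sumr mulr_sumr; apply: eq_bigr => p _.
  rewrite /= (ht_dot tensP) [dotF (_ *: _) _]linearZl_LR.
  by rewrite [dotG (_ *: _) _]linearZl_LR/=; exact: (@mulrACA R[i]).
rewrite (cintegrable_sum _ _).2; last first.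
  by move=> p; exact: (cintegral_tensor (wf p.1).1 (wg p.2).1).1.
apply: eq_bigr => p _; rewrite /= (ht_dot tensP).
rewrite (cintegral_tensor (wf p.1).1 (wg p.2).1).2.
by rewrite (wf p.1).2 (wg p.2).2.
Qed.

End TensorProduct.

(** * Dual pairs in the completion of the quotient *)

Section Completion.
Context (R : realType) (n : nat) (H : lmodType R[i]).
Context (ip : nInnerProduct n H) (a : n.-1.-tuple H).
Context (HF : lmodType R[i]) (dotF : {dot HF for (@Num.conj R[i])}).
Context (iota : {linear H -> HF}).
Hypothesis complF : quotient_completion ip a dotF iota.
Context (d : measure_display) (X : measurableType d).
Context (mu : {measure set X -> \bar R}).

Lemma nnorm_completion f : nnorm ip f a = hnorm dotF (iota f).
Proof. by rewrite /nnorm /hnorm (qc_dot complF). Qed.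

Lemma hdense_iota : hdense dotF (fun u => exists x, u = iota x).
Proof.
move=> u e e0; have [x ux] := qc_dense complF u e0.
by exists (iota x) => //; exists x.
Qed.

(** The maximum with 1 provides a positive bound, as required of the constants
of a frame. *)
Lemma hbessel_completion (F : X -> H) (B : R) : bessel_family ip a mu F B ->
  hbessel dotF mu (fun x => iota (F x)) (Num.max B 1).
Proof.
move=> [mF leF]; apply: hbessel_dense hdense_iota _.
have dotE f : (fun x => dotF (iota f) (iota (F x))) = (fun x => ip f (F x) a).
  by apply/funext => x; rewrite (qc_dot complF).
split=> _ [f ->]; rewrite dotE; first exact: mF.
apply: le_trans (leF f) _; rewrite lee_fin nnorm_completion.
by rewrite ler_wpM2r ?sqr_ge0// le_max lexx.
Qed.

Lemma dual_pair_completion (F G : X -> H) (B B' : R) f :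
  dual_bessel_pair ip a mu F G B B' ->
  weak_integral mu dotF
    (fun x => dotF (iota f) (iota (F x)) *: iota (G x)) (iota f).
Proof.
move=> [bF bG dualFG].
have hF := hbessel_completion bF; have hG := hbessel_completion bG.
apply: weak_integral_dense (hF.1 _ I) (hF.2 (iota f) I) hG hdense_iota _.
move=> _ [g ->]; rewrite (qc_dot complF) dualFG.
by congr (cintegral mu _); apply/funext => x; rewrite !(qc_dot complF).
Qed.

(** Conjugating the reproducing formula exchanges the two families; it yields
the frame property of the second one. *)
Lemma dual_pair_symm (F G : X -> H) (B B' : R) :
  dual_bessel_pair ip a mu F G B B' -> dual_bessel_pair ip a mu G F B' B.
Proof.
move=> dual; have [bF bG dualFG] := dual; split=> // f g.
have [int_gf _] := dual_pair_completion g dual (iota f).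
rewrite nip_conj dualFG -cintegralJ; last first.
  move: int_gf; congr (cintegrable mu _); apply/funext => x.
  by rewrite linearZl_LR /= !(qc_dot complF).
congr (cintegral mu _); apply/funext => x.
by rewrite rmorphM /= -!nip_conj mulrC.
Qed.

Lemma dual_pair_lower_bound (F G : X -> H) (B B' : R) f :
  dual_bessel_pair ip a mu F G B B' ->
  (((4 * Num.max B' 1)^-1 * nnorm ip f a ^+ 2)%:E <=
     L2sq mu (fun x => ip f (F x) a))%E.
Proof.
move=> [bF bG dualFG]; rewrite nnorm_completion.
have -> : (fun x => ip f (F x) a) = (fun x => dotF (iota f) (iota (F x))).
  by apply/funext => x; rewrite (qc_dot complF).
have hF := hbessel_completion bF; have hG := hbessel_completion bG.
apply: L2sq_reproducing_ge hF hG _; first by rewrite lt_max ltr01 orbT.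
rewrite (qc_dot complF) dualFG.
by congr (cintegral mu _); apply/funext => x; rewrite !(qc_dot complF).
Qed.

End Completion.

(** * The tensor product of two dual pairs *)

Section TensorFrame.
Context (R : realType) (n : nat) (H1 H2 : lmodType R[i]).
Context (ip1 : nInnerProduct n H1) (ip2 : nInnerProduct n H2).
Context (a : n.-1.-tuple H1) (b : n.-1.-tuple H2).
Context (HF HG : lmodType R[i]).
Context (dotF : {dot HF for (@Num.conj R[i])}).
Context (dotG : {dot HG for (@Num.conj R[i])}).
Context (iF : {linear H1 -> HF}) (iG : {linear H2 -> HG}).
Hypothesis complF : quotient_completion ip1 a dotF iF.
Hypothesis complG : quotient_completion ip2 b dotG iG.
Context (d1 d2 : measure_display).
Context (X1 : measurableType d1) (X2 : measurableType d2).
Context (mu1 : {sigma_finite_measure set X1 -> \bar R}).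
Context (mu2 : {sigma_finite_measure set X2 -> \bar R}).

Lemma dual_pair_tensor_frame (F1 G1 : X1 -> H1) (F2 G2 : X2 -> H2)
    (B1 B2 D1 D2 : R) :
  dual_bessel_pair ip1 a mu1 F1 G1 B1 B2 ->
  dual_bessel_pair ip2 b mu2 F2 G2 D1 D2 ->
  tensor_frame ip1 ip2 a b (mu1 \x mu2)%E F1 F2.
Proof.
move=> dual1 dual2; have [[mF1 leF1] _ _] := dual1.
have [[mF2 leF2] _ _] := dual2.
have max_gt0 (r : R) : 0 < Num.max r 1 by rewrite lt_max ltr01 orbT.
split=> [f g|]; first exact: (cmeasurable_tensor (mF1 f) (mF2 g)).
exists ((4 * Num.max B2 1)^-1 * (4 * Num.max D2 1)^-1).
exists (Num.max B1 1 * Num.max D1 1).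
split=> [||f g I]; rewrite ?mulr_gt0 ?invr_gt0 ?mulr_gt0//.
have -> : I = (L2sq mu1 (fun x => ip1 f (F1 x) a)
             * L2sq mu2 (fun x => ip2 g (F2 x) b))%E.
  by rewrite -(L2sq_tensor mu1 mu2 (mF1 f) (mF2 g)).
have le_max_mul (r s : R) : 0 <= s -> r * s <= Num.max r 1 * s.
  by move=> s0; rewrite ler_wpM2r// le_max lexx.
rewrite /tensor_norm exprMn; split; rewrite mulrACA EFinM; apply: lee_pmul.
- by rewrite lee_fin mulr_ge0 ?sqr_ge0// ltW// invr_gt0 mulr_gt0.
- by rewrite lee_fin mulr_ge0 ?sqr_ge0// ltW// invr_gt0 mulr_gt0.
- exact: (dual_pair_lower_bound complF f dual1).
- exact: (dual_pair_lower_bound complG g dual2).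
- exact: L2sq_ge0.
- exact: L2sq_ge0.
- by apply: le_trans (leF1 f) _; rewrite lee_fin le_max_mul// sqr_ge0.
- by apply: le_trans (leF2 g) _; rewrite lee_fin le_max_mul// sqr_ge0.
Qed.

End TensorFrame.

Theorem theorem4p10 (R : realType) (n : nat) (n_ge2 : (2 <= n)%N)
  (H1 H2 : lmodType R[i])
  (ip1 : nInnerProduct n H1) (ip2 : nInnerProduct n H2)
  (dimH1 : dim_ge H1 n) (dimH2 : dim_ge H2 n)
  (hilH1 : nHilbert ip1) (hilH2 : nHilbert ip2)
  (a : n.-1.-tuple H1) (b : n.-1.-tuple H2)
  (a_indep : lin_indep a) (b_indep : lin_indep b)
  (HF HG T : lmodType R[i])
  (dotF : {dot HF for (@Num.conj R[i])})
  (dotG : {dot HG for (@Num.conj R[i])})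
  (dotT : {dot T for (@Num.conj R[i])})
  (iF : {linear H1 -> HF}) (iG : {linear H2 -> HG})
  (tens : {bilinear HF -> HG -> T})
  (complF : quotient_completion ip1 a dotF iF)
  (complG : quotient_completion ip2 b dotG iG)
  (tensFG : hilbert_tensor dotF dotG dotT tens)
  (d1 d2 : measure_display)
  (X1 : measurableType d1) (X2 : measurableType d2)
  (mu1 : {sigma_finite_measure set X1 -> \bar R})
  (mu2 : {sigma_finite_measure set X2 -> \bar R})
  (F1 G1 : X1 -> H1) (F2 G2 : X2 -> H2) (B1 B2 D1 D2 : R)
  (dual1 : dual_bessel_pair ip1 a mu1 F1 G1 B1 B2)
  (dual2 : dual_bessel_pair ip2 b mu2 F2 G2 D1 D2) :
  dual_tensor_frame ip1 ip2 a b (mu1 \x mu2)%E dotT iF iG tens F1 F2 G1 G2.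
Proof.
have [bF1 bG1 _] := dual1; have [bF2 bG2 _] := dual2.
split.
- exact: (dual_pair_tensor_frame complF complG dual1 dual2).
- exact: (dual_pair_tensor_frame complF complG (dual_pair_symm complF dual1)
    (dual_pair_symm complG dual2)).
move=> f g.
have -> : (fun x : X1 * X2 => tensor_ip ip1 ip2 a b f g (F1 x.1) (F2 x.2)
      *: etens iF iG tens (G1 x.1) (G2 x.2)) =
    (fun x : X1 * X2 => (dotF (iF f) (iF (F1 x.1)) * dotG (iG g) (iG (F2 x.2)))
      *: tens (iF (G1 x.1)) (iG (G2 x.2))).
  by apply/funext => x; rewrite (qc_dot complF) (qc_dot complG).
have D2_ge0 : 0 <= Num.max D2 1 by rewrite le_max ler01 orbT.
exact: (weak_integral_tensor tensFG D2_ge0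
  (hbessel_completion complF bF1) (hbessel_completion complF bG1)
  (hbessel_completion complG bF2) (hbessel_completion complG bG2)
  (dual_pair_completion complF f dual1) (dual_pair_completion complG g dual2)).
Qed.
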